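(* Let $G$ be an infinite group and let $\kappa=|G|$. If the cardinal $\kappa$ is singular, then the corona $\nu_\kappa(G)$ of the coarse space $(G,\mathcal{E}_\kappa)$ is a singleton.
   Context: Coarse structures. A coarse structure on a set $X$ is a family $\mathcal{E}$ of subsets of $X\times X$ such that: each $E\in\mathcal{E}$ contains the diagonal $\triangle_X=\{(x,x):x\in X\}$; if $E,E'\in\mathcal{E}$ then $E\circ E'\in\mathcal{E}$ and $E^{-1}\in\mathcal{E}$, where $E\circ E'=\{(x,y):\exists z\ ((x,z)\in E,\ (z,y)\in E')\}$ and $E^{-1}=\{(y,x):(x,y)\in E\}$; if $E\in\mathcal{E}$ and $\triangle_X\subseteq E'\subseteq E$ then $E'\in\mathcal{E}$; for all $x,y\in X$ there is $E\in\mathcal{E}$ with $(x,y)\in E$. The pair $(X,\mathcal{E})$ is called a coarse space (or ballean). A subfamily $\mathcal{E}'\subseteq\mathcal{E}$ is a base for $\mathcal{E}$ if every $E\in\mathcal{E}$ is contained in some $E'\in\mathcal{E}'$. For $x\in X$, $A\subseteq X$, $E\in\mathcal{E}$ put $E[x]=\{y\in X:(x,y)\in E\}$ and $E[A]=\bigcup_{a\in A}E[a]$. A subset $B\subseteq X$ is bounded if $B\subseteq E[a]$ for some $E\in\mathcal{E}$, $a\in X$. Corona. Give $X$ the discrete topology and let $\beta X$ be its Stone–Čech compactification, viewed as the set of ultrafilters on $X$, with basic open sets $\{q\in\beta X:A\in q\}$, $A\subseteq X$. Let $X^\sharp$ be the set of all $q\in\beta X$ such that each member of $q$ is unbounded in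 $(X,\mathcal{E})$, with the subspace topology. For $r,q\in X^\sharp$ write $r\,\|\,q$ if there is $E\in\mathcal{E}$ with $E[R]\in q$ for each $R\in r$; this is an equivalence relation on $X^\sharp$. Let $\sim$ be the smallest (by inclusion) equivalence relation on $X^\sharp$ that is closed in $X^\sharp\times X^\sharp$ and contains $\|$. The (Higson's) corona of $(X,\mathcal{E})$ is the quotient space $X^\sharp/\sim$. The balanced coarse structure of a group. For an infinite group $G$ and an infinite cardinal $\kappa\le|G|$, let $[G]^{<\kappa}$ be the family of subsets of $G$ of cardinality $<\kappa$. $\mathcal{E}_\kappa$ is the coarse structure on $G$ with the base consisting of the sets $\{(x,y):y\in FxF\}$, where $F\in[G]^{<\kappa}$ contains the identity of $G$. The corona of $(G,\mathcal{E}_\kappa)$ is denoted by $\nu_\kappa(G)$. *)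

(* Defs.v *)
From HB Require Import structures.
From mathcomp Require Import all_boot all_order all_algebra.
From mathcomp Require Import all_classical wochoice topology.

Set Implicit Arguments.
Unset Strict Implicit.
Unset Printing Implicit Defensive.

Local Open Scope classical_set_scope.
Local Open Scope card_scope.
Local Open Scope quotient_scope.

Definition card_lt T U (A : set T) (B : set U) : bool := ~~ (B #<= A).
Notation "A '#<' B" := (card_lt A B) (at level 79, format "A  '#<'  B") :
  card_scope.

(* The type K stands for the cardinal |K|.  An initial well-order is one of
   order type the initial ordinal |K|. *)
Definition initial_well_order (K : Type) (R : rel K) :=
  well_order R /\
  forall x, [set y | R y x /\ y <> x] #< [set: K].

Definition cofinal_in (K : Type) (R : rel K) (C : set K) :=
  forall x, exists2 c, C c & R x c.

(* |K| is infinite and cf |K| < |K|; the initial well-order of K is unique up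
   to isomorphism. *)
Definition singular_cardinal (K : Type) :=
  infinite_set [set: K] /\
  exists R : rel K, initial_well_order R /\
  exists C : set K, cofinal_in R C /\ C #< [set: K].

Section CardinalArithmetic.

Lemma card_leI T U (A : set T) (B : set U) (f : T -> U) :
  (forall x, A x -> B (f x)) ->
  (forall x y, A x -> A y -> f x = f y -> x = y) -> A #<= B.
Proof.
move=> fAB finj; apply: (@card_le_trans _ _ _ (f @` A)).
  have fi : {in A &, injective f}.
    by move=> x y /set_mem Ax /set_mem Ay; exact: finj.
  by rewrite (card_le_eqr (inj_card_eq fi)) card_lexx.
by apply: subset_card_le => _ [x Ax <-]; exact: fAB.
Qed.

Lemma card_leE T U (A : set T) (B : set U) (u0 : U) : A #<= B ->
  exists2 f : T -> U, (forall x, A x -> B (f x)) &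
    (forall x y, A x -> A y -> f x = f y -> x = y).
Proof.
move=> /card_leP[g].
have [f fE] : exists f : T -> U, forall x (h : x \in A), f x = \val (g (exist _ x h)).
  have /choice[f Pf] : forall x, exists u, forall h : x \in A,
      u = \val (g (exist _ x h)).
    move=> x; have [h|nh] := pselect (x \in A); last by exists u0.
    by exists (\val (g (exist _ x h))) => h'; congr (val (g _)); apply: val_inj.
  by exists f.
exists f => [x Ax|x y Ax Ay].
  by rewrite (fE _ (mem_set Ax)); apply: set_valP.
rewrite (fE _ (mem_set Ax)) (fE _ (mem_set Ay)) => /val_inj.
by move/(@inj _ _ _ g) => /(_ (in_setT _) (in_setT _)) /(congr1 val).
Qed.

(* Comparability of cardinals. *)
Lemma card_le_total T (t0 : T) (A B : set T) : A #<= B \/ B #<= A.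
Proof.
pose valid (p : set T * (T -> T)) := [/\ p.1 `<=` A,
  (forall x, p.1 x -> B (p.2 x)) &
  (forall x y, p.1 x -> p.1 y -> p.2 x = p.2 y -> x = y)].
pose P := {p | valid p}.
pose le (p q : P) := `[< (sval p).1 `<=` (sval q).1 /\
  forall x, (sval p).1 x -> (sval p).2 x = (sval q).2 x >].
have v0 : valid (set0, id) by split.
have [| | |[[D f] [DA fB finj]] max] := @ZL_preorder P (exist _ _ v0) le.
- by move=> p; apply/asboolP; split.
- move=> r s t /asboolP[rs rsE] /asboolP[st stE]; apply/asboolP; split.
    exact: subset_trans st.
  by move=> x rx; rewrite rsE // stE //; exact: rs.
- move=> F Ftot.
  pose D := [set x | exists2 p, F p & (sval p).1 x].
  have /choice[f fE] : forall x, exists y, forall p, F p -> (sval p).1 x ->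
      (sval p).2 x = y.
    move=> x; have [[p Fp px]|nD] := pselect (D x); last first.
      by exists t0 => p Fp px; exfalso; apply: nD; exists p.
    exists ((sval p).2 x) => q Fq qx.
    by have [/asboolP[_ ->]|/asboolP[_ ->]] := Ftot _ _ Fp Fq.
  have vD : valid (D, f).
    split => /= [x [p _ px]|x [p Fp px]|x y [p Fp px] [q Fq qy]].
    + by have [pA _ _] := svalP p; exact: pA.
    + by rewrite -(fE x p) //; have [_ + _] := svalP p; apply.
    + have [/asboolP[pq _]|/asboolP[qp _]] := Ftot _ _ Fp Fq.
        rewrite -(fE x q) //; last exact: pq.
        by rewrite -(fE y q) //; have [_ _] := svalP q; apply => //; exact: pq.
      rewrite -(fE y p) //; last exact: qp.
      by rewrite -(fE x p) //; have [_ _] := svalP p; apply => //; exact: qp.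
  exists (exist _ _ vD) => p Fp; apply/asboolP; split => /=.
    by move=> x px; exists p.
  by move=> x px; rewrite (fE x p).
have {}max (q : P) : D `<=` (sval q).1 ->
    (forall x, D x -> f x = (sval q).2 x) -> (sval q).1 `<=` D.
  by move=> Dq fq; have /asboolP[] := max q (asboolT (conj Dq fq)).
have [AD|/existsNP[a /not_implyP[Aa nDa]]] := pselect (A `<=` D).
  left; apply: (@card_leI _ _ _ _ f) => [x /AD|x y /AD + /AD]; first exact: fB.
  exact: finj.
right; have [Bf|/existsNP[b /not_implyP[Bb nfb]]] := pselect (B `<=` f @` D).
  apply: card_le_trans (subset_card_le Bf) _.
  by apply: card_le_trans (card_image_le _ _) _; exact: subset_card_le.
exfalso.
pose g x := if x == a :> {classic T} then b else f x.
have ga : g a = b by rewrite /g eqxx.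
have gD x : D x -> g x = f x.
  by move=> Dx; rewrite /g; case: eqP => // xa; rewrite -xa in nDa.
have vg : valid (D `|` [set a], g).
  split => /= [x [/DA//|->//]|x [Dx|->]|x y [Dx|->] [Dy|->]].
  - by rewrite gD //; exact: fB.
  - by rewrite ga.
  - by rewrite !gD //; exact: finj.
  - by rewrite ga gD // => fx; exfalso; apply: nfb; exists x.
  - by rewrite ga gD // => fx; exfalso; apply: nfb; exists y.
  - by [].
have /= Dmax := max (exist _ _ vg).
apply: nDa; apply: Dmax => [x Dx|x Dx|]; [by left|by rewrite gD|by right].
Qed.

(* Hessenberg's theorem. *)
Lemma card_setX_infinite T (A : set T) : infinite_set A -> A `*` A #<= A.
Proof.
move=> Ainf.
pose valid (p : set T * (T -> T -> T)) := [/\ p.1 `<=` A, infinite_set p.1,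
  (forall x y, p.1 x -> p.1 y -> p.1 (p.2 x y)) &
  (forall x y x' y', p.1 x -> p.1 y -> p.1 x' -> p.1 y' ->
    p.2 x y = p.2 x' y' -> x = x' /\ y = y')].
pose P := {p | valid p}.
pose le (p q : P) := `[< (sval p).1 `<=` (sval q).1 /\
  forall x y, (sval p).1 x -> (sval p).1 y -> (sval p).2 x y = (sval q).2 x y >].
have [a0 Aa0] : A !=set0 by exact: infinite_setN0.
have [p0 v0] : exists p, valid p.
  have [i iA iinj] := card_leE a0 ((infiniteP A).1 Ainf).
  have [j _ jinj] := card_leE (point : nat) ((card_eqPle _ _).1 card_nat2).1.
  pose N := range i.
  have /choice[k kE] : forall x, exists n, N x -> i n = x.
    move=> x; have [[n _ <-]|nN] := pselect (N x); first by exists n.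
    by exists 0%N.
  exists (N, fun x y => i (j (k x, k y))); split => /=.
  - by move=> _ [n _ <-]; exact: iA.
  - apply/infiniteP; apply: (@card_leI _ _ _ _ i) => [n _|]; first by exists n.
    by move=> *; exact: iinj.
  - by move=> x y _ _; exists (j (k x, k y)).
  - move=> x y x' y' Nx Ny Nx' Ny' /(iinj _ _ I I) /(jinj _ _ I I) [kx ky].
    by rewrite -(kE _ Nx) -(kE _ Ny) kx ky !kE.
have [| | |[[D f] [DA Dinf fD finj]] max] := @ZL_preorder P (exist _ _ v0) le.
- by move=> p; apply/asboolP; split.
- move=> r s t /asboolP[rs rsE] /asboolP[st stE]; apply/asboolP; split.
    exact: subset_trans st.
  by move=> x y rx ry; rewrite rsE // stE //; exact: rs.
- move=> F Ftot.
  have [[q0 Fq0]|F0] := pselect (F !=set0); last first.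
    by exists (exist _ _ v0) => s Fs; exfalso; apply: F0; exists s.
  pose D := [set x | exists2 p, F p & (sval p).1 x].
  have /choice[g gE] : forall xy, exists z, forall p, F p -> (sval p).1 xy.1 ->
      (sval p).1 xy.2 -> (sval p).2 xy.1 xy.2 = z.
    move=> [x y] /=.
    have [[p [Fp px py]]|nD] :=
        pselect (exists p, [/\ F p, (sval p).1 x & (sval p).1 y]); last first.
      by exists a0 => p Fp px py; exfalso; apply: nD; exists p.
    exists ((sval p).2 x y) => q Fq qx qy.
    by have [/asboolP[_ ->]|/asboolP[_ ->]] := Ftot _ _ Fp Fq.
  have D2 x y : D x -> D y -> exists p, [/\ F p, (sval p).1 x & (sval p).1 y].
    move=> [p Fp px] [q Fq qy].
    have [/asboolP[pq _]|/asboolP[qp _]] := Ftot _ _ Fp Fq.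
      by exists q; split => //; exact: pq.
    by exists p; split => //; exact: qp.
  have vD : valid (D, fun x y => g (x, y)).
    split => /=.
    + by move=> x [p _ px]; have [pA _ _ _] := svalP p; exact: pA.
    + have [_ qinf _ _] := svalP q0; apply: sub_infinite_set qinf.
      by move=> x qx; exists q0.
    + move=> x y Dx Dy; have [p [Fp px py]] := D2 _ _ Dx Dy.
      exists p => //; rewrite -(gE (x, y) p) //=.
      by have [_ _ + _] := svalP p; apply.
    + move=> x y x' y' Dx Dy Dx' Dy'.
      have [p [Fp px py]] := D2 _ _ Dx Dy.
      have [q [Fq qx qy]] := D2 _ _ Dx' Dy'.
      have [r [Fr rx ry rx' ry']] : exists r, [/\ F r, (sval r).1 x, (sval r).1 y,
          (sval r).1 x' & (sval r).1 y'].
        have [/asboolP[pq _]|/asboolP[qp _]] := Ftot _ _ Fp Fq.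
          by exists q; split => //; exact: pq.
        by exists p; split => //; exact: qp.
      rewrite -(gE (x, y) r) // -(gE (x', y') r) //=.
      by have [_ _ _] := svalP r; apply.
  exists (exist _ _ vD) => p Fp; apply/asboolP; split => /=.
    by move=> x px; exists p.
  by move=> x y px py; rewrite (gE (x, y) p).
have {}max (q : P) : D `<=` (sval q).1 ->
    (forall x y, D x -> D y -> f x y = (sval q).2 x y) -> (sval q).1 `<=` D.
  by move=> Dq fq; have /asboolP[] := max q (asboolT (conj Dq fq)).
have [i iD iinj] := card_leE a0 ((infiniteP D).1 Dinf).
have DD : D `*` D #<= D.
  apply: (@card_leI _ _ _ _ (fun p => f p.1 p.2)) => [[x y] [/= Dx Dy]|].
    exact: fD.
  move=> [x y] [x' y'] [/= Dx Dy] [/= Dx' Dy'] fxy.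
  by have [-> ->] := finj _ _ _ _ Dx Dy Dx' Dy' fxy.
have [ADD|DAD] := card_le_total a0 (A `\` D) D.
  have AD : A #<= D.
    have [h hD hinj] := card_leE a0 ADD.
    apply: card_le_trans DD.
    apply: (@card_leI _ _ _ _
      (fun x => if `[< D x >] then (x, i 0%N) else (h x, i 1%N))).
      move=> x Ax; case: asboolP => Dx; split => //=; try exact: iD.
      exact: hD.
    move=> x y Ax Ay; case: asboolP => Dx; case: asboolP => Dy.
    + by case.
    + by case=> _ /(iinj _ _ I I).
    + by case=> _ /(iinj _ _ I I).
    + by case=> /hinj; apply.
  apply: card_le_trans (subset_card_le DA); apply: card_le_trans DD.
  have [h hD hinj] := card_leE a0 AD.
  apply: (@card_leI _ _ _ _ (fun p => (h p.1, h p.2))).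
    by move=> [x y] [/= Ax Ay]; split; exact: hD.
  by move=> [x y] [x' y'] [/= Ax Ay] [/= Ax' Ay'] [/hinj-> // /hinj->].
exfalso.
have [h hD hinj] := card_leE a0 DAD.
have /choice[k kE] : forall x, exists z, (h @` D) x -> D z /\ h z = x.
  move=> x; have [[z Dz <-]|nhx] := pselect ((h @` D) x); first by exists z.
  by exists a0.
pose E := D `|` h @` D.
pose a x := if `[< D x >] then x else k x.
pose c x y := i (if `[< D x >] then 0%N else if `[< D y >] then 1%N else 2%N).
pose g x y := if `[< D x >] && `[< D y >] then f x y
  else h (f (f (a x) (a y)) (c x y)).
have cD x y : D (c x y) by exact: iD.
have aD x : E x -> D (a x).
  rewrite /a; case: asboolP => // nDx [//|hx].
  by have [] := kE _ hx.
have hND x : D x -> ~ D (h x) by move=> /hD[].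
have ainj x x' : E x -> E x' -> `[< D x >] = `[< D x' >] -> a x = a x' -> x = x'.
  rewrite /a => Ex Ex'; case: asboolP => Dx; case: asboolP => Dx' // _.
  have hx : (h @` D) x by case: Ex.
  have hx' : (h @` D) x' by case: Ex'.
  by move=> kk; rewrite -(kE _ hx).2 -(kE _ hx').2 kk.
have gDD x y : D x -> D y -> g x y = f x y.
  by move=> Dx Dy; rewrite /g !asboolT.
have gh x y : ~ (D x /\ D y) -> g x y = h (f (f (a x) (a y)) (c x y)).
  by move=> nD; rewrite /g; case: asboolP => //= Dx; case: asboolP => //= Dy;
    exfalso; apply: nD.
have vg : valid (E, g).
  split => /=.
  - by move=> x [/DA //|[z /hD[Ahz _] <-]].
  - by apply: sub_infinite_set Dinf => x Dx; left.
  - move=> x y Ex Ey; have [[Dx Dy]|nD] := pselect (D x /\ D y).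
      by rewrite gDD //; left; exact: fD.
    rewrite gh //; right; exists (f (f (a x) (a y)) (c x y)) => //.
    by apply: (fD _ _ _ (cD _ _)); apply: fD; exact: aD.
  - have gD x y : E x -> E y -> D (g x y) -> D x /\ D y.
      move=> Ex Ey; apply: contraPP => nD; rewrite gh //; apply: hND.
      by apply: (fD _ _ _ (cD _ _)); apply: fD; exact: aD.
    move=> x y x' y' Ex Ey Ex' Ey' gg.
    have [[Dx Dy]|nD] := pselect (D x /\ D y).
      have [Dx' Dy'] : D x' /\ D y'.
        by apply: gD => //; rewrite -gg gDD //; exact: fD.
      by move: gg; rewrite !gDD //; exact: finj.
    have [[Dx' Dy']|nD'] := pselect (D x' /\ D y').
      by exfalso; apply: nD; apply: gD => //; rewrite gg gDD //; exact: fD.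
    have Dxy := fD _ _ (aD _ Ex) (aD _ Ey).
    have Dxy' := fD _ _ (aD _ Ex') (aD _ Ey').
    move: gg; rewrite !gh // => /(hinj _ _ (fD _ _ Dxy (cD _ _)) (fD _ _ Dxy' (cD _ _))).
    move=> /(finj _ _ _ _ Dxy (cD _ _) Dxy' (cD _ _)) [].
    move=> /(finj _ _ _ _ (aD _ Ex) (aD _ Ey) (aD _ Ex') (aD _ Ey')) [axx ayy].
    move=> /(iinj _ _ I I) cc.
    have [dx dy] : `[< D x >] = `[< D x' >] /\ `[< D y >] = `[< D y' >].
      move: cc nD nD'.
      case: (asboolP (D x)) => ?; case: (asboolP (D y)) => ?;
      case: (asboolP (D x')) => ?; case: (asboolP (D y')) => ? // _ nD nD';
      by [exfalso; apply: nD | exfalso; apply: nD'].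
    by split; exact: ainj.
have /= Dmax := max (exist _ _ vg).
apply: (hND (i 0%N) (iD _ I)); apply: Dmax => [x Dx|x y Dx Dy|].
- by left.
- by rewrite gDD.
- by right; exists (i 0%N) => //; exact: iD.
Qed.

Lemma card_setX_lt T (K : Type) (A B : set T) : infinite_set [set: K] ->
  A #< [set: K] -> B #< [set: K] -> A `*` B #< [set: K].
Proof.
move=> Kinf AK BK; apply/negP => KAB.
have [[t _]|A0] := pselect (A !=set0); last first.
  apply: Kinf; apply: card_le_finite KAB _.
  have -> : A `*` B = set0.
    by rewrite -subset0 => -[x y] [/= Ax _]; exfalso; apply: A0; exists x.
  exact: finite_set0.
have main (C : set T) : C #< [set: K] -> [set: K] #<= C `*` C -> False.
  move=> /negP CK KC; apply: CK.
  have Cinf : infinite_set C.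
    by move=> Cfin; apply: Kinf; apply: card_le_finite KC _; exact: finite_setX.
  exact: card_le_trans KC (card_setX_infinite Cinf).
have [AB|BA] := card_le_total t A B.
  apply: (main _ BK); apply: card_le_trans KAB _.
  have [f fAB finj] := card_leE t AB.
  apply: (@card_leI _ _ _ _ (fun p => (f p.1, p.2))).
    by move=> [x y] [/= Ax By]; split => //=; exact: fAB.
  by move=> [x y] [x' y'] [/= Ax By] [/= Ax' By'] [/finj -> // ->].
apply: (main _ AK); apply: card_le_trans KAB _.
have [f fBA finj] := card_leE t BA.
apply: (@card_leI _ _ _ _ (fun p => (p.1, f p.2))).
  by move=> [x y] [/= Ax By]; split => //=; exact: fBA.
by move=> [x y] [x' y'] [/= Ax By] [/= Ax' By'] [-> /finj ->].
Qed.

End CardinalArithmetic.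

Section CoarseSpaces.
Local Open Scope relation_scope.

(* E' \; E is the library's spelling of the composition E o E'. *)
Record coarse_structure (X : Type) := CoarseStructure {
  controlled : set (set (X * X)) ;
  controlled_diag : forall E, controlled E -> diagonal `<=` E ;
  controlled_comp : forall E E', controlled E -> controlled E' ->
    controlled (E' \; E) ;
  controlled_inv : forall E, controlled E -> controlled E^-1 ;
  controlled_sub : forall E E', controlled E -> diagonal `<=` E' ->
    E' `<=` E -> controlled E' ;
  controlled_conn : forall x y, exists2 E, controlled E & E (x, y) }.

Definition coarse_base (X : Type) (C : coarse_structure X)
    (B : set (set (X * X))) :=
  B `<=` controlled C /\
  forall E, controlled C E -> exists2 E', B E' & E `<=` E'.

(* E[A]; E[x] is the library's xsection E x. *)
Definition coarse_ball (X : Type) (E : set (X * X)) (A : set X) : set X :=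
  \bigcup_(a in A) xsection E a.

Definition coarse_bounded (X : Type) (C : coarse_structure X) (B : set X) :=
  exists E a, controlled C E /\ B `<=` xsection E a.

End CoarseSpaces.

Section StoneCech.

(* The Stone-Cech compactification of the discrete space X. *)
Record beta (X : Type) := Beta {
  beta_sets : set_system X ;
  beta_ultra : UltraFilter beta_sets }.

Context (X : Type).

HB.instance Definition _ := gen_eqMixin (beta X).
HB.instance Definition _ := gen_choiceMixin (beta X).

Definition beta_basic (A : set X) : set (beta X) := [set q : beta X | beta_sets q A].

Let beta_basic_cover : \bigcup_(A in [set: set X]) beta_basic A = setT.
Proof.
apply/seteqP; split => // q _; exists setT => //.
by have Fq := beta_ultra q; exact: filterT.
Qed.

Let beta_basic_join (A B : set X) (q : beta X) : setT A -> setT B ->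
  beta_basic A q -> beta_basic B q ->
  exists C, [/\ setT C, beta_basic C q &
    beta_basic C `<=` beta_basic A `&` beta_basic B].
Proof.
move=> _ _ qA qB; exists (A `&` B); split => //.
  by have Fq := beta_ultra q; exact: filterI.
move=> r rAB; have Fr := beta_ultra r.
by split; apply: filterS rAB => x [].
Qed.

HB.instance Definition _ :=
  isBaseTopological.Build (beta X) beta_basic_cover beta_basic_join.

End StoneCech.

Section Corona.
Context (X : Type) (C : coarse_structure X).

Definition sharp : set (beta X) :=
  [set q : beta X | forall A, beta_sets q A -> ~ coarse_bounded C A].

(* The coercion of sharp to a type carries the subspace topology. *)
Definition sharp_space : topologicalType := sharp.

Definition parallel (r q : sharp_space) : Prop :=
  exists2 E, controlled C E &
    forall R, beta_sets (\val r) R -> beta_sets (\val q) (coarse_ball E R).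

Definition closed_equivalence (S : topologicalType) (R : rel S) :=
  equivalence_rel R /\ closed [set p : S * S | R p.1 p.2].

Definition corona_rel : rel sharp_space := fun r q =>
  `[< forall R : rel sharp_space, closed_equivalence R ->
        (forall x y, parallel x y -> R x y) -> R r q >].

Lemma corona_rel_parallel r q : parallel r q -> corona_rel r q.
Proof. by move=> rq; apply/asboolP => R _; exact. Qed.

Lemma corona_rel_min (R : rel sharp_space) : closed_equivalence R ->
  (forall x y, parallel x y -> R x y) -> forall x y, corona_rel x y -> R x y.
Proof. by move=> Rce pR x y /asboolP; apply. Qed.

Lemma corona_rel_refl : reflexive corona_rel.
Proof. by move=> x; apply/asboolP => R [Req _] _; have [] := Req x x x. Qed.

Lemma corona_rel_sym : symmetric corona_rel.
Proof.
have sub x y : corona_rel x y -> corona_rel y x.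
  move=> /asboolP xy; apply/asboolP => R Rce pR; have [Req _] := Rce.
  by have [Rxx /(_ (xy _ Rce pR)) <-] := Req x y x.
by move=> x y; apply/idP/idP; exact: sub.
Qed.

Lemma corona_rel_trans : transitive corona_rel.
Proof.
move=> y x z /asboolP xy /asboolP yz; apply/asboolP => R Rce pR.
have [Req _] := Rce; have [_ /(_ (xy _ Rce pR)) ->] := Req x y z.
exact: yz.
Qed.

Lemma corona_rel_closed_equivalence : closed_equivalence corona_rel.
Proof.
split.
  move=> x y z; split; first exact: corona_rel_refl.
  move=> xy; apply/idP/idP; last exact: corona_rel_trans.
  by apply: corona_rel_trans; rewrite corona_rel_sym.
have -> : [set p | corona_rel p.1 p.2] = \bigcap_(R in
    [set R | closed_equivalence R /\ forall x y, parallel x y -> R x y])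
    [set p : sharp_space * sharp_space | R p.1 p.2].
  apply/seteqP; split => p /=.
    by move=> /asboolP pR R [Rce RR]; exact: pR.
  by move=> pR; apply/asboolP => R Rce RR; exact: (pR R).
by apply: closed_bigI => R [[_ +] _].
Qed.

Canonical corona_equiv :=
  EquivRel corona_rel corona_rel_refl corona_rel_sym corona_rel_trans.

Definition corona : topologicalType :=
  quotient_topology {eq_quot corona_equiv}.

End Corona.

Section BalancedCoarseStructure.
Context (G : groupType) (K : Type).

Local Open Scope group_scope.

Definition balanced_entourage (F : set G) : set (G * G) :=
  [set xy | exists f g, [/\ F f, F g & xy.2 = f * xy.1 * g]].

Definition balanced_base : set (set (G * G)) :=
  [set balanced_entourage F | F in [set F : set G | F 1 /\ F #< [set: K]]].

Definition balanced_controlled : set (set (G * G)) :=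
  [set E | diagonal `<=` E /\ exists2 E', balanced_base E' & E `<=` E'].

Lemma balanced_diag (F : set G) : F 1 -> diagonal `<=` balanced_entourage F.
Proof. by move=> F1 [x y] /diagonalP <-; exists 1, 1; rewrite mul1g mulg1. Qed.

Context (Kinf : infinite_set [set: K]).

Let mul_lt (A B : set G) : A #< [set: K] -> B #< [set: K] ->
  [set p.1 * p.2 | p in A `*` B] #< [set: K].
Proof.
move=> AK BK; apply/negP => KAB; have /negP := card_setX_lt Kinf AK BK; apply.
exact: card_le_trans KAB (card_image_le _ _).
Qed.

Let balanced_comp E E' : balanced_controlled E -> balanced_controlled E' ->
  balanced_controlled (E' \; E)%relation.
Proof.
move=> [dE [_ [F [F1 FK] <-] EF]] [dE' [_ [F' [F'1 F'K] <-] EF']]; split.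
  by move=> [x y] xy; exists x => /=; [exact: dE|exact: dE'].
pose H := [set p.1 * p.2 | p in [set p.1 * p.2 | p in F' `*` F] `*` F'].
exists (balanced_entourage H).
  exists H => //; split; last by apply: mul_lt => //; exact: mul_lt.
  exists (1, 1); last by rewrite mulg1.
  by split => //; exists (1, 1); [|rewrite mulg1].
move=> [x y] [z /= /EF[f [g [Ff Fg /= ->]]] /EF'[f' [g' [Ff' Fg' /= ->]]]].
exists (f' * f), (g * g'); split.
- exists (f' * f, 1); last by rewrite mulg1.
  by split => //; exists (f', f).
- exists (g, g') => //; split => //.
  by exists (1, g); [|rewrite mul1g].
- by rewrite /= !mulgA.
Qed.

Let balanced_inv E : balanced_controlled E -> balanced_controlled (E^-1)%relation.
Proof.
move=> [dE [_ [F [F1 FK] <-] EF]]; split.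
  by move=> [x y] /= xy; apply: dE => /=.
exists (balanced_entourage [set f^-1 | f in F]).
  exists [set f^-1 | f in F] => //; split; first by exists 1; rewrite ?invg1.
  apply/negP => KF; have /negP := FK; apply.
  exact: card_le_trans KF (card_image_le _ _).
move=> [x y] /= /EF[f [g [Ff Fg /= ->]]].
exists f^-1, g^-1; split; [by exists f|by exists g|].
by rewrite /= !mulgA mulVg mul1g mulgK.
Qed.

Let balanced_sub E E' : balanced_controlled E -> diagonal `<=` E' ->
  E' `<=` E -> balanced_controlled E'.
Proof.
move=> [_ [E0 bE0 EE0]] dE' E'E; split => //; exists E0 => //.
exact: subset_trans EE0.
Qed.

Let balanced_conn x y : exists2 E, balanced_controlled E & E (x, y).
Proof.
pose F := [set 1; x^-1 * y].
have F1 : F 1 by left.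
exists (balanced_entourage F).
  split; first exact: balanced_diag.
  exists (balanced_entourage F) => //; exists F => //; split => //.
  by apply/negP => KF; apply: Kinf; apply: card_le_finite KF _;
    rewrite finite_setU.
exists 1, (x^-1 * y); split => //=; first by right.
by rewrite mul1g mulVKg.
Qed.

(* The coarse structure E_kappa for kappa = |K|. *)
Definition balanced_coarse : coarse_structure G :=
  CoarseStructure (fun E => @proj1 _ _) balanced_comp balanced_inv
    balanced_sub balanced_conn.

Lemma balanced_coarse_base : coarse_base balanced_coarse balanced_base.
Proof.
split=> [_ [F [F1 FK] <-]|E [_ //]]; split; first exact: balanced_diag.
by exists (balanced_entourage F) => //; exists F.
Qed.

End BalancedCoarseStructure.
Arguments balanced_coarse G K Kinf : clear implicits.

(* Main.v *)
(* Let small mean of cardinality < |G|, so that the points of X^# are the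
   ultrafilters without small members. If a closed equivalence R containing
   || does not identify r and q, compactness gives A in r, B in q and A'
   such that FAF \ A' and FBF /\ A' are small for all small F. Singularity
   makes the sets {x in A | x g notin A'} bounded in cardinality uniformly
   in g by some mu < |G|: otherwise cf |G| many elements g would form a
   small F with FAF \ A' not small. Choose a small X in A with |X| > mu. The
   g in B with x g in A' for some x in X lie in the small set X^-1 (XB /\
   A'), so some g in B satisfies x g notin A' for all x in X, which
   contradicts |X| > mu. *)
Require Import Defs.
From mathcomp Require Import all_boot all_order all_algebra.
From mathcomp Require Import all_classical topology.

Set Implicit Arguments.
Unset Strict Implicit.
Unset Printing Implicit Defensive.

Local Open Scope classical_set_scope.

Lemma ultrafilter_setVsetC (T : Type) (F : set_system T) : ProperFilter F ->
  (forall A, F A \/ F (~` A)) -> UltraFilter F.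
Proof.
move=> PF FC; constructor => // H PH FH; apply/seteqP; split => // A HA.
have [//|/FH HAC] := FC A.
by have [x []] := filter_ex (filterI HA HAC).
Qed.

Lemma beta_of_filter (X : Type) (F : set_system X) : ProperFilter F ->
  exists q : beta X, F `<=` beta_sets q.
Proof.
by move=> PF; have [H [HU FH]] := ultraFilterLemma PF; exists (Beta HU).
Qed.

(** * Compactness of the space of ultrafilters with unbounded members *)

Section SharpTopology.
Context (X : Type) (C : coarse_structure X).
Implicit Types (x y : sharp_space C) (A : set X).

Definition sharp_basic A : set (sharp_space C) :=
  [set x | beta_sets (\val x) A].

Definition sharp_point (q : beta X) (qC : sharp C q) : sharp_space C :=
  exist (fun q => q \in sharp C) q (mem_set qC).

Lemma nbhs_sharpP x (U : set (sharp_space C)) :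
  nbhs x U <-> exists2 A, sharp_basic A x & sharp_basic A `<=` U.
Proof.
split=> [|[A xA AU]].
  rewrite nbhsE => -[_ [[V [D _ <-] <-]] /= [A DA xA] VU].
  by exists A => // y yA; apply: VU; exists A.
apply: (filterS AU); apply: open_nbhs_nbhs; split=> //.
exists (beta_basic A) => //; exists [set A] => //.
by rewrite bigcup_set1.
Qed.

Lemma sharp_basicT x : sharp_basic setT x.
Proof. by have := beta_ultra (\val x) => xU; exact: filterT. Qed.

Lemma sharp_basicI A B x : sharp_basic A x -> sharp_basic B x ->
  sharp_basic (A `&` B) x.
Proof. by have := beta_ultra (\val x) => xU; exact: filterI. Qed.

Lemma sharp_basicS A B : A `<=` B -> sharp_basic A `<=` sharp_basic B.
Proof. by move=> AB x; have := beta_ultra (\val x) => xU; exact: filterS. Qed.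

Lemma sharp_basic_disjoint A x :
  sharp_basic A x -> sharp_basic (~` A) x -> False.
Proof.
have := beta_ultra (\val x) => xU /filterI /[apply] /filter_ex.
by case=> z [].
Qed.

Lemma sharp_basicVC A x : sharp_basic A x \/ sharp_basic (~` A) x.
Proof. by have := beta_ultra (\val x) => xU; exact: in_ultra_setVsetC. Qed.

(** An ultrafilter [F] on the space converges to the ultrafilter [p] of those [A] with
    [sharp_basic A] in [F]; such an [A] is unbounded because [sharp_basic A] is nonempty. *)
Lemma sharp_compact : compact [set: sharp_space C].
Proof.
rewrite compact_ultra => F FU _.
pose p : set_system X := [set A | F (sharp_basic A)].
have pP : ProperFilter p.
  split.
    move=> /(@filter_ex _ F)[x /sharp_basic_disjoint]; apply.
    by rewrite setC0; exact: sharp_basicT.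
  constructor.
  - by apply: (@filterS _ F) filterT => x _; exact: sharp_basicT.
  - move=> A B FA FB; apply: (@filterS _ F) (@filterI _ F _ _ _ FA FB) => x [].
    exact: sharp_basicI.
  - by move=> A B AB; apply: (@filterS _ F); exact: sharp_basicS.
have pU : UltraFilter p.
  apply: ultrafilter_setVsetC => A.
  have [|FA] := in_ultra_setVsetC (sharp_basic A) FU; first by left.
  right; apply: filterS FA => x xA.
  by have [/xA|] := sharp_basicVC A x.
have pS : sharp C (Beta pU).
  by move=> A /= /(@filter_ex _ F)[x xA]; exact: (@set_valP _ (sharp C) x _ xA).
exists (sharp_point pS); split=> // U /nbhs_sharpP[A].
by move=> pA /filterS; exact.
Qed.

(** * Closed equivalence relations on this compact space *)

Section ClosedEquivalence.
Context (R : rel (sharp_space C)).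
Hypothesis (Rce : closed_equivalence R).

Lemma closed_equivalence_closed x y :
  (forall A B, sharp_basic A x -> sharp_basic B y ->
     exists x' y', [/\ sharp_basic A x', sharp_basic B y' & R x' y']) ->
  R x y.
Proof.
move=> xy; have [_ Rcl] := Rce; apply: (Rcl (x, y)).
move=> V [[U W] /= [/nbhs_sharpP[A xA AU] /nbhs_sharpP[B yB BW]] UWV].
have [x' [y' [x'A y'B Rxy]]] := xy _ _ xA yB.
by exists (x', y'); split => //; apply: UWV; split; [exact: AU|exact: BW].
Qed.

Lemma closed_equivalence_sym x y : R x y -> R y x.
Proof. by have [Req _] := Rce; have [Rxx /[apply] <-] := Req x y x. Qed.

Lemma closed_equivalence_trans x y z : R x y -> R y z -> R x z.
Proof. by have [Req _] := Rce; have [_ /[apply] ->] := Req x y z. Qed.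

(** Upper semicontinuity of classes, by compactness: otherwise the sets [D B] form a filter base
    with a cluster point [y], which closedness of [R] puts in the class of [x], although [y] is a
    limit of points outside the clopen set [sharp_basic A]. *)
Lemma class_nbhs x A : (forall y, R x y -> sharp_basic A y) ->
  exists2 B, sharp_basic B x &
    forall x' y, sharp_basic B x' -> R x' y -> sharp_basic A y.
Proof.
move=> xA.
pose D B :=
  [set y | exists2 x', sharp_basic B x' & R x' y /\ ~ sharp_basic A y].
pose F := filter_from (sharp_basic^~ x) D.
have [[B xB DB0]|nD] := pselect (exists2 B, sharp_basic B x & D B = set0).
  exists B => // x' y x'B Rxy; apply: contrapT => yA.
  by rewrite -[False]/(set0 y) -DB0; exists x'.
have PF : ProperFilter F.
  apply: filter_from_proper; last first.
    by move=> B xB; apply/set0P/eqP => DB; apply: nD; exists B.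
  apply: filter_from_filter.
    by exists setT; exact: sharp_basicT.
  move=> B B' xB xB'; exists (B `&` B'); first exact: sharp_basicI.
  move=> y [x' x'B Rxy]; split; exists x' => //;
    by apply: sharp_basicS x'B => ? [].
have [y [_ Fy]] := sharp_compact PF filterT.
suff /xA yA : R x y.
  have [z [[x' _ [_ zA]]]] : D setT `&` sharp_basic A !=set0.
    apply: Fy; last by apply/nbhs_sharpP; exists A.
    by exists setT => //; exact: sharp_basicT.
  by move/zA.
apply: closed_equivalence_closed => B B' xB yB'.
have [z [[x' x'B [Rxz _]] zB']] : D B `&` sharp_basic B' !=set0.
  by apply: Fy; [exists B|apply/nbhs_sharpP; exists B'].
by exists x', z.
Qed.

(** Disjoint compact sets are separated by a clopen set. If not, the traces on the class of [y] of
    the basic sets containing the class of [x] have a cluster point [z], which lies in both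
    classes. *)
Lemma class_separation x y : ~ R x y -> exists A,
  (forall z, R x z -> sharp_basic A z) /\
  (forall z, R y z -> sharp_basic (~` A) z).
Proof.
move=> nRxy.
pose F := filter_from [set A | forall z, R x z -> sharp_basic A z]
  (fun A => [set z | R y z /\ sharp_basic A z]).
apply: contrapT => nA.
have PF : ProperFilter F.
  apply: filter_from_proper; last first.
    move=> A xA; apply/set0P/eqP => A0; apply: nA; exists A; split=> // z Ryz.
    have [zA|//] := sharp_basicVC A z.
    by have : set0 z by rewrite -A0.
  apply: filter_from_filter.
    by exists setT => z _; exact: sharp_basicT.
  move=> B B' xB xB'; exists (B `&` B').
    by move=> z Rxz; apply: sharp_basicI; [exact: xB|exact: xB'].
  by move=> z [Ryz zB]; split; split=> //; apply: sharp_basicS zB => ? [].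
have [z [_ Fz]] := sharp_compact PF filterT.
have Ryz : R y z.
  apply: closed_equivalence_closed => B B' yB zB'.
  have [w [[Ryw _] wB']] :
      [set z | R y z /\ sharp_basic setT z] `&` sharp_basic B' !=set0.
    apply: Fz; last by apply/nbhs_sharpP; exists B'.
    by exists setT => // w _; exact: sharp_basicT.
  by exists y, w.
apply: nRxy; apply: closed_equivalence_trans (closed_equivalence_sym Ryz).
(* If the class of [x] missed the neighbourhood [B'] of [z], the complement of [B'] would be one of
   the sets defining [F], and [z] could not be a cluster point. *)
apply: closed_equivalence_closed => B B' xB zB'; apply: contrapT => nBB'.
have [w [[_ wB] wB']] :
    [set w | R y w /\ sharp_basic (~` B') w] `&` sharp_basic B' !=set0.
  apply: Fz; last by apply/nbhs_sharpP; exists B'.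
  exists (~` B') => // w Rxw; have [wB'|//] := sharp_basicVC B' w.
  by exfalso; apply: nBB'; exists x, w.
exact: sharp_basic_disjoint wB' wB.
Qed.

End ClosedEquivalence.
End SharpTopology.

(** * Sets of cardinality below that of an infinite type *)

Section SmallSets.
Local Open Scope card_scope.
Context (T : Type).
Hypothesis (Tinf : infinite_set [set: T]).

Lemma card_le_lt_trans U V W (A : set U) (B : set V) (C : set W) :
  A #<= B -> B #< C -> A #< C.
Proof. by move=> AB; apply: contra => CA; exact: card_le_trans CA AB. Qed.

Lemma subset_card_lt U W (A B : set U) (C : set W) :
  A `<=` B -> B #< C -> A #< C.
Proof. by move=> /subset_card_le; exact: card_le_lt_trans. Qed.

Lemma image_card_lt U V W (f : U -> V) (A : set U) (C : set W) :
  A #< C -> f @` A #< C.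
Proof. by apply: card_le_lt_trans; exact: card_image_le. Qed.

Lemma finite_card_lt U (A : set U) : finite_set A -> A #< [set: T].
Proof.
by move=> Afin; apply/negP => TA; apply: Tinf; exact: card_le_finite TA Afin.
Qed.

(** With [k x] an index whose set contains [x], and [e i] an injection of [F i] into [M], sending
    [x] to [(k x, e (k x) x)] embeds the union in the product of [I] and [M]. *)
Lemma bigcup_card_lt (I M : set T) (F : T -> set T) :
  I #< [set: T] -> M #< [set: T] -> (forall i, I i -> F i #<= M) ->
  \bigcup_(i in I) F i #< [set: T].
Proof.
move=> IT MT FM; apply: card_le_lt_trans (card_setX_lt Tinf IT MT).
have [t _] := infinite_setN0 Tinf.
have /choice[e eP] : forall i, exists f : T -> T, I i ->
    (forall x, F i x -> M (f x)) /\
    (forall x y, F i x -> F i y -> f x = f y -> x = y).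
  move=> i; have [/FM /(card_leE t)[f fM finj]|nIi] := pselect (I i).
    by exists f.
  by exists id.
have /choice[k kP] :
    forall x, exists i, (\bigcup_(i in I) F i) x -> I i /\ F i x.
  move=> x; have [[i Ii Fix]|nx] := pselect ((\bigcup_(i in I) F i) x).
    by exists i.
  by exists t.
apply: (@card_leI _ _ _ _ (fun x => (k x, e (k x) x))).
  by move=> x /kP[Ik Fk]; split => //=; have [+ _] := eP _ Ik; apply.
move=> x y /kP[Ikx Fkx] /kP[Iky Fky] [kxy]; rewrite -kxy in Fky *.
by have [_] := eP _ Ikx; apply.
Qed.

Lemma setU_card_lt (A B : set T) :
  A #< [set: T] -> B #< [set: T] -> A `|` B #< [set: T].
Proof.
have [a _] := infinite_setN0 Tinf.
wlog AB : A B / A #<= B => [th AT BT|AT BT].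
  have [AB|BA] := card_le_total a A B; first exact: th.
  by rewrite setUC; exact: th.
have [b ab] : exists b, b <> a.
  apply: contrapT => nb; apply: Tinf; apply: (sub_finite_set _ (finite_set1 a)).
  by move=> b _; apply: contrapT => ba; apply: nb; exists b.
pose F i := if `[< i = a >] then A else B.
apply: (@subset_card_lt _ _ _ (\bigcup_(i in [set a; b]) F i)).
  move=> x [Ax|Bx]; [exists a; first by left|exists b; first by right].
    by rewrite /F asboolT.
  by rewrite /F asboolF.
apply: (bigcup_card_lt _ BT).
  by apply: finite_card_lt; rewrite finite_setU.
by move=> i _; rewrite /F; case: ifP => _ //; exact: card_lexx.
Qed.

(** The cover consists of the closed initial segments ending at the points of a cofinal set. *)
Lemma singular_cardinal_cover : singular_cardinal T ->
  exists (C : set T) (I : T -> set T), [/\ C #< [set: T],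
    forall c, I c #< [set: T] & \bigcup_(c in C) I c = setT].
Proof.
move=> [_ [R [[_ Rlt] [C [Ccof CT]]]]].
exists C, (fun c => [set y | R y c /\ y <> c] `|` [set c]); split => //.
  move=> c; apply: setU_card_lt => //; apply: finite_card_lt.
  exact: finite_set1.
apply/seteqP; split => // x _; have [c Cc Rxc] := Ccof x.
by exists c => //; have [->|xc] := pselect (x = c); [right|left].
Qed.

End SmallSets.

(** * Cardinal bounds from a small cover by small sets *)

Section SmallCover.
Local Open Scope card_scope.
Context (T : Type) (C : set T) (I : T -> set T).
Hypotheses (Tinf : infinite_set [set: T]) (CT : C #< [set: T]).
Hypotheses (IT : forall c, I c #< [set: T]) (CI : \bigcup_(c in C) I c = setT).

(** Otherwise [T] would be a union, over the small set [C], of sets of size at most that of [M],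
    hence small. *)
Lemma cover_cofinal (M : set T) : M #< [set: T] ->
  exists2 c, C c & ~~ (I c #<= M).
Proof.
move=> MT; apply: contrapT => nc; have /negP := MT; apply.
suff /negP : \bigcup_(c in C) I c #< [set: T] by rewrite CI card_lexx.
apply: (bigcup_card_lt Tinf CT MT) => c Cc; apply: contrapT => /negP IM.
by apply: nc; exists c.
Qed.

(** Counterexamples [h c] to the bounds [I c], one for each [c] in [C], would share a small bound
    [M], but some [I c] exceeds [M]. *)
Lemma uniform_bound (J : Type) (S : J -> set T) :
  (forall h : T -> J, exists2 M : set T, M #< [set: T] &
     forall c, C c -> S (h c) #<= M) ->
  exists c, forall j, S j #<= I c.
Proof.
move=> SM; apply: contrapT => nc.
have /choice[h hP] : forall c, exists j, ~~ (S j #<= I c).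
  move=> c; apply: contrapT => nj; apply: nc; exists c => j.
  by apply: contrapT => /negP SI; apply: nj; exists j.
have [M MT hM] := SM h.
have [c Cc IM] := cover_cofinal MT.
have [t _] := infinite_setN0 Tinf.
have [MI|IM'] := card_le_total t M (I c); last by rewrite IM' in IM.
by have /negP := hP c; apply; exact: card_le_trans (hM _ Cc) MI.
Qed.

(** An injective copy in [A] of some [I c] exceeding [M]. *)
Lemma exists_small_subset_not_le (A M : set T) : ~~ (A #< [set: T]) -> M #< [set: T] ->
  exists X, [/\ X `<=` A, X #< [set: T] & ~~ (X #<= M)].
Proof.
rewrite negbK => TA MT; have [c Cc IM] := cover_cofinal MT.
have [t _] := infinite_setN0 Tinf.
have [f fA finj] := card_leE t TA.
exists (f @` I c); split.
- by move=> _ [x _ <-]; exact: fA.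
- exact: image_card_lt.
- apply: contra IM; apply: card_le_trans.
  by apply: (@card_leI _ _ _ _ f) => [x Ix|x y _ _]; [exists x|exact: finj].
Qed.

End SmallCover.

(** * Ultrafilters and closed equivalences for the balanced coarse structure *)

Section BalancedCorona.
Local Open Scope card_scope.
Local Open Scope group_scope.
Context (G : groupType).
Hypothesis (Ginf : infinite_set [set: G]).
Local Notation E := (balanced_coarse G G Ginf).
Local Notation small A := (A #< [set: G]).

(** The product FAF, that is, the ball around [A] for the entourage [balanced_entourage F]. *)
Definition sandwich (F A : set G) : set G :=
  [set p.1 * p.2 | p in [set p.1 * p.2 | p in F `*` A] `*` F].

Lemma mul_small (A B : set G) : small A -> small B ->
  small [set p.1 * p.2 | p in A `*` B].
Proof. by move=> As Bs; apply: image_card_lt; exact: card_setX_lt. Qed.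

Lemma sandwichP (F A : set G) x :
  sandwich F A x <-> exists f a g, [/\ F f, A a, F g & x = f * a * g].
Proof.
split=> [[[_ g] [/= [[f a] /= [Ff Aa] <-] Fg] <-]|[f [a [g [Ff Aa Fg ->]]]]].
  by exists f, a, g.
by exists (f * a, g) => //; split => //; exists (f, a).
Qed.

Lemma sandwich_small (F A : set G) : small F -> small A -> small (sandwich F A).
Proof. by move=> Fs As; do 2!apply: mul_small => //. Qed.

Lemma balanced_entourage_controlled (F : set G) : F 1 -> small F ->
  controlled E (balanced_entourage F).
Proof.
move=> F1 Fs; have [sub _] := balanced_coarse_base G Ginf.
by apply: sub; exists F.
Qed.

Lemma balanced_bounded_small (B : set G) : coarse_bounded E B <-> small B.
Proof.
split=> [[E0 [a [[_ [_ [F [_ Fs] <-] sE]] BE]]]|Bs].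
  have as_ := finite_card_lt Ginf (finite_set1 a).
  apply: subset_card_lt (sandwich_small Fs as_).
  move=> x /BE /xsectionP /sE[f [g [Ff Fg /= ->]]].
  by apply/sandwichP; exists f, a, g.
exists (balanced_entourage (1 |` B)), 1; split.
  apply: balanced_entourage_controlled; first by left.
  by apply: setU_card_lt => //; apply: finite_card_lt => //; exact: finite_set1.
move=> b Bb; apply/xsectionP; exists 1, b; split; [by left|by right|].
by rewrite /= mul1g mul1g.
Qed.

Lemma balanced_sharpP (q : beta G) :
  sharp E q <-> forall A, beta_sets q A -> ~~ (small A).
Proof.
by split=> qE A /qE As; [apply/negP|move/negP : As];
  rewrite ?balanced_bounded_small // => /balanced_bounded_small.
Qed.

(** Any ultrafilter refining the filter of sets that contain all but a small part of [S] works: it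
    contains the complement of every small set. *)
Lemma exists_sharp (S : set G) : ~~ (small S) ->
  exists q : sharp_space E, sharp_basic S q.
Proof.
move=> Sn.
pose F : set_system G := [set A | small (S `\` A)].
have PF : ProperFilter F.
  split; first by rewrite /F /= setD0 => /idP; exact/negP.
  split; rewrite /F /=.
  - by rewrite setDT; apply: finite_card_lt.
  - by move=> A B SA SB; rewrite /mkset setDIr; exact: setU_card_lt.
  - by move=> A B AB; apply: subset_card_lt; exact: setDS.
have [q Fq] := beta_of_filter PF.
have qU := beta_ultra q.
have qS : sharp E q.
  apply/balanced_sharpP => A qA; apply/negP => As.
  have /(filterI qA)/filter_ex[x []//] : beta_sets q (~` A).
  by apply: Fq; rewrite /F /= setDE setCK; apply: subset_card_lt As.
exists (sharp_point qS); apply: Fq.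
by rewrite /F /= setDv; apply: finite_card_lt.
Qed.

(* A uniform ultrafilter containing S, pushed forward along a selector mapping
   each point of S to a point of A it is F-close to. *)
Lemma exists_parallel (F A S : set G) : F 1 -> small F -> ~~ (small S) ->
  S `<=` sandwich F A ->
  exists r q : sharp_space E,
    [/\ sharp_basic A r, sharp_basic S q & parallel r q].
Proof.
move=> F1 Fs /exists_sharp[q qS] SFA.
have qU := beta_ultra (\val q).
have /choice[s sP] : forall x, exists a, S x ->
    A a /\ exists f g, [/\ F f, F g & x = f * a * g].
  move=> x; have [/SFA/sandwichP[f [a [g [? ? ? ?]]]]|] := pselect (S x).
    by exists a => _; split => //; exists f, g.
  by exists 1.
pose p : set_system G := [set R | beta_sets (\val q) (s @^-1` R)].
have pU : UltraFilter p.
  apply: ultrafilter_setVsetC.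
  by move=> R; exact: (in_ultra_setVsetC (s @^-1` R) qU).
have sR R : S `&` s @^-1` R `<=` sandwich F R.
  move=> x [/sP[_ [f [g [Ff Fg xE]]]] Rx]; apply/sandwichP.
  by exists f, (s x), g.
have pE : sharp E (Beta pU).
  (* A small [R] in [p] would make [sandwich F R] small, while by [sR] that set contains a member of
     [q]. *)
  apply/balanced_sharpP => R /= pR; apply/negP => Rs.
  have /balanced_sharpP/(_ _ (filterI qS pR))/negP := @set_valP _ (sharp E) q.
  apply; apply: subset_card_lt (sandwich_small Fs Rs); exact: sR.
exists (sharp_point pE), q; split => //.
  rewrite /sharp_basic /= /p /=; apply: filterS qS => x /sP[]//.
exists (balanced_entourage F); first exact: balanced_entourage_controlled.
move=> R /= pR; apply: filterS (filterI qS pR) => x /sR.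
move=> /sandwichP[f [a [g [Ff Ra Fg ->]]]].
by exists a => //; apply/xsectionP; exists f, g.
Qed.

Lemma no_separation (A B A' : set G) : singular_cardinal G ->
  ~~ (small A) -> ~~ (small B) ->
  (forall F : set G, F 1 -> small F -> small (sandwich F A `\` A')) ->
  (forall F : set G, F 1 -> small F -> small (sandwich F B `&` A')) -> False.
Proof.
move=> /(singular_cardinal_cover Ginf)[C [I [Cs Is CI]]] An Bn AA' BA'.
have small1 (F : set G) : small F -> small (1 |` F).
  by apply: setU_card_lt => //; apply: finite_card_lt => //; exact: finite_set1.
have [c cP] : exists c, forall g : G, [set x | A x /\ ~ A' (x * g)] #<= I c.
  apply: (uniform_bound Ginf Cs CI) => h.
  (* Collecting all [h c] into one small [F] gives a common bound: right translation by [h c] embeds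
     each of the sets in FAF minus [A']. *)
  have hs : small (1 |` h @` C) by apply: small1; exact: image_card_lt.
  exists (sandwich (1 |` h @` C) A `\` A'); first by apply: AA' => //; left.
  move=> c Cc.
  apply: (@card_leI _ _ _ _ ( *%g^~ (h c))) => [x [Ax xA']|x y _ _].
    split => //; apply/sandwichP; exists 1, x, (h c).
    split => //; first by left.
      by right; exists c.
    by rewrite mul1g.
  exact: mulIg.
have [X [XA Xs XI]] := exists_small_subset_not_le Ginf Cs Is CI An (Is c).
pose N := sandwich (1 |` X) B `&` A'.
have Ns : small N by apply: BA'; [left|exact: small1].
(* A [g] in [B] that fails has [x * g] in [N] for some [x] in [X], so it lies in the product of the
   inverses of [X] with [N], which is small and cannot contain [B]. *)
have [g Bg gP] : exists2 g, B g & forall x, X x -> ~ A' (x * g).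
  apply: contrapT => ng; move/negP : Bn; apply.
  apply: (@subset_card_lt _ _ _
    [set p.1 * p.2 | p in [set x^-1 | x in X] `*` N]); last first.
    by apply: mul_small => //; exact: image_card_lt.
  move=> g Bg.
  have [x Xx xgA'] : exists2 x, X x & A' (x * g).
    apply: contrapT => nx; apply: ng; exists g => // x Xx xgA'.
    by apply: nx; exists x.
  exists (x^-1, x * g); last by rewrite /= mulKg.
  split => /=; first by exists x.
  split => //; apply/sandwichP; exists x, g, 1; split; rewrite ?mulg1 //;
    by [right|left].
move/negP : XI; apply; apply: card_le_trans (cP g).
by apply: subset_card_le => x Xx; split; [exact: XA|exact: gP].
Qed.

(** If FAF minus [A'] were not small, [exists_parallel] would give a [q] containing it and parallel
    to some [r] containing [A]; then [AA'] forces [A'] into [q], a contradiction. The argument for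
    [B] uses the complement of [A']. *)
Lemma closed_equivalence_full (R : rel (sharp_space E)) :
  singular_cardinal G -> closed_equivalence R ->
  (forall x y, parallel x y -> R x y) -> forall x y, R x y.
Proof.
move=> Gs Rce pR x y; apply: contrapT => nRxy.
have [A' [xA' yA']] := class_separation Rce nRxy.
have [A xA AA'] := class_nbhs Rce xA'.
have [B yB BA'] := class_nbhs Rce yA'.
have not_small (z : sharp_space E) D : sharp_basic D z -> ~~ small D.
  by move=> zD; have /balanced_sharpP := @set_valP _ (sharp E) z; apply.
apply: (no_separation Gs (not_small _ _ xA) (not_small _ _ yB) (A' := A')).
  move=> F F1 Fs; apply: contrapT => /negP nS.
  have [r [q [rA qS rq]]] := exists_parallel F1 Fs nS (@subDsetl _ _ _).
  apply: (@sharp_basic_disjoint _ _ A' q); first exact: AA' rA (pR _ _ rq).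
  by apply: sharp_basicS qS => z [].
move=> F F1 Fs; apply: contrapT => /negP nS.
have [r [q [rB qS rq]]] := exists_parallel F1 Fs nS (@subIsetl _ _ _).
apply: (@sharp_basic_disjoint _ _ A' q); last exact: BA' rB (pR _ _ rq).
by apply: sharp_basicS qS => z [].
Qed.

End BalancedCorona.

Unset Implicit Arguments.

Theorem theorem4 (G : groupType) (Ginf : infinite_set [set: G]) :
  singular_cardinal G ->
  exists c : corona (balanced_coarse G G Ginf),
    [set: corona (balanced_coarse G G Ginf)] = [set c].
Proof.
move=> Gs.
(* The corona is nonempty because [G] itself is not small. *)
have [|q _] := @exists_sharp G Ginf [set: G]; first by rewrite negbK card_lexx.
exists (\pi_(corona (balanced_coarse G G Ginf)) q)%qT.
apply/seteqP; split => // x _ /=; elim/quotW : x => r.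
apply/eqmodP/asboolP => R Rce pR; exact: closed_equivalence_full.
Qed.
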